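(* Let $h:\mathbf{C}\to\mathbf{C}$ be a chaotic homeomorphism of the Cantor space. Then there exist $\Phi=(\varphi^L,\varphi^U)$ such that $\mathbf{F}_\Phi$ is a Lelek fence and a chaotic homeomorphism $\hat h$ of $\mathbf{F}_\Phi$ such that $h$ is the canonical factor of $\hat h$, i.e. $\hat h(y,t)=(h(y),s)$ for some $s$, for all $(y,t)\in\mathbf{F}_\Phi$.
   Context: A map is chaotic (in the sense of Devaney) if it is transitive and its periodic points are dense. For $\Phi=(\varphi^L,\varphi^U)$ with $\varphi^L,\varphi^U:\mathbf{C}\to[0,1]$, $\varphi^L$ lower semicontinuous, $\varphi^U$ upper semicontinuous, $\varphi^L\le\varphi^U$, the fence is $\mathbf{F}_\Phi=\{(x,t)\in\mathbf{C}\times[0,1]:\varphi^L(x)\le t\le\varphi^U(x)\}$. $\mathbf{F}_\Phi$ is a Lelek fence if $\varphi^L\equiv0$, $\varphi^U$ is positive on a dense subset of $\mathbf{C}$, and the graph $\{(x,\varphi^U(x)):x\in\mathbf{C}\}$ is dense in $\mathbf{F}_\Phi$. *)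

(* Defs.v *)
From HB Require Import structures.
From mathcomp Require Import all_boot all_order all_algebra.
From mathcomp Require Import all_classical all_reals all_analysis.
Set Implicit Arguments. Unset Strict Implicit. Unset Printing Implicit Defensive.
Import Order.TTheory GRing.Theory Num.Theory.
Import numFieldTopology.Exports.
Local Open Scope classical_set_scope.
Local Open Scope ring_scope.

Definition lsc {X : topologicalType} {R : realType} (f : X -> R) :=
  forall x (a : R), a < f x -> \forall y \near x, a < f y.
Definition usc {X : topologicalType} {R : realType} (f : X -> R) :=
  forall x (a : R), f x < a -> \forall y \near x, f y < a.

(* Dynamics on a subspace F of a topological space T (subspace topology:
   the open sets of F are the sets U `&` F with U open in T). *)

Definition dense_in {T : topologicalType} (F D : set T) :=
  D `<=` F /\ forall U : set T, open U -> U `&` F !=set0 -> U `&` D !=set0.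

Definition homeo_on {T : topologicalType} (F : set T) (f : T -> T) :=
  (forall x, F x -> F (f x)) /\ {within F, continuous f} /\
  exists g : T -> T, (forall x, F x -> F (g x)) /\ {within F, continuous g} /\
    (forall x, F x -> g (f x) = x) /\ (forall x, F x -> f (g x) = x).

Definition transitive_on {T : topologicalType} (F : set T) (f : T -> T) :=
  forall U V : set T, open U -> open V -> U `&` F !=set0 -> V `&` F !=set0 ->
    exists n : nat, (0 < n)%N /\ exists x, (U `&` F) x /\ V (iter n f x).

Definition periodic_points {T : topologicalType} (F : set T) (f : T -> T) :=
  [set x | F x /\ exists n : nat, (0 < n)%N /\ iter n f x = x].

(* Chaotic in the sense of Devaney: transitive with dense periodic points. *)
Definition chaotic_on {T : topologicalType} (F : set T) (f : T -> T) :=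
  transitive_on F f /\ dense_in F (periodic_points F f).

Definition admissible {R : realType} (phiL phiU : cantor_space -> R) :=
  (forall x, 0 <= phiL x <= 1) /\ (forall x, 0 <= phiU x <= 1) /\
  lsc phiL /\ usc phiU /\ (forall x, phiL x <= phiU x).

Definition fence {R : realType} (phiL phiU : cantor_space -> R)
  : set (cantor_space * R) :=
  [set p | phiL p.1 <= p.2 <= phiU p.1].

Definition graph_of {R : realType} (phi : cantor_space -> R)
  : set (cantor_space * R) := [set p | p.2 = phi p.1].

Definition lelek_fence {R : realType} (phiL phiU : cantor_space -> R) :=
  (forall x, phiL x = 0) /\
  dense [set x | 0 < phiU x] /\
  dense_in (fence phiL phiU) (graph_of phiU).

(* Main.v *)
(** We look for [hh (y, t) = (h y, t * exp (- G y))] preserving the region under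
    [phi = exp (- sum_n v_n)], where the [v_n >= 0] are continuous with
    [|v_n o h - v_n| <= 2^-n]: then [phi] is upper semicontinuous and
    [G = sum_n (v_n o h - v_n)] is continuous, with [phi (h y) = phi y * exp (- G y)].
    Since [hh] maps tops of fibres to tops of fibres, it is enough that, for all
    open [U], [V] meeting the fence, some periodic [p] has [(p, phi p)] in [U] and
    [(h^k p, phi (h^k p))] in [V]; this gives at once density of the graph,
    density of the periodic points and transitivity.  It is achieved one pair of
    basic open sets at a time: as there are no isolated points, one finds small
    clopen sets [A], [B] in the bases, away from the finitely many periodic
    orbits used so far and not reaching each other within [N] iterates; [v_n] is
    the sum of a bump of height [c] on [A] and one of height [c'] on [B], both
    decreasing to 0 in [N] steps of size at most [2^-n / 2] along orbits, and the
    new periodic orbit goes from [A] to [B].  Later terms vanish on this orbit. *)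
Require Import Defs.
From HB Require Import structures.
From mathcomp Require Import all_boot all_order all_algebra.
From mathcomp Require Import all_classical all_reals all_analysis.
From mathcomp Require Import ring lra.
Set Implicit Arguments. Unset Strict Implicit. Unset Printing Implicit Defensive.
Import Order.TTheory GRing.Theory Num.Theory.
Import numFieldTopology.Exports.
Local Open Scope classical_set_scope.
Local Open Scope ring_scope.

(** * Topology of the Cantor space *)

Definition cylinder (s : seq bool) : set cantor_space :=
  [set y | forall i, (i < size s)%N -> y i = nth false s i].

Lemma nbhs_coord (y : cantor_space) (i : nat) :
  \forall z \near y, z i = y i.
Proof.
have /(_ y) := @proj_continuous nat (fun=> bool : topologicalType) i.
by move=> /(_ [set b | b = y i]); apply; rewrite nbhs_principalE /=.
Qed.

Lemma clopen_cylinder (s : seq bool) : clopen (cylinder s).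
Proof.
split.
  rewrite openE => y ys; rewrite /interior.
  have := @filter_forall _ 'I_(size s) (fun i (z : cantor_space) => z i = y i)
    (nbhs y) (nbhs_filter y) (nbhs_coord y).
  by apply: filterS => z zy i isz; rewrite (zy (Ordinal isz)) ys.
rewrite -openC openE => y /existsNP[i /not_implyP[isz yi]].
near=> z; move=> /(_ i isz); apply: contra_not yi => <-; apply/esym.
by near: z; exact: nbhs_coord.
Unshelve. all: by end_near. Qed.

Lemma cylinder_mkseq (x : cantor_space) (n : nat) : cylinder (mkseq x n) x.
Proof. by move=> i; rewrite size_mkseq => ?; rewrite nth_mkseq. Qed.

(** Every point outside an open [V] around [x] differs from [x] at some coordinate, and this
    coordinate also serves nearby points. Compactness of the complement bounds these coordinates by
    one [n], so the cylinder of the first [n] bits of [x] lies in [V]. *)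
Lemma cylinder_basis (x : cantor_space) (U : set cantor_space) :
  nbhs x U -> exists2 s, cylinder s x & cylinder s `<=` U.
Proof.
rewrite nbhsE => -[V [oV Vx] VU].
have /compact_near_coveringP cK : compact (~` V).
  by apply: (subclosed_compact _ cantor_space_compact) => //; exact: open_closedC.
have [|n _ nP] := cK nat \oo (fun n y => exists2 i, (i < n)%N & x i <> y i) _.
  move=> y nVy.
  have [i xyi] : exists i, x i <> y i.
    apply/existsNP => xy; apply: nVy; suff <- : x = y by [].
    by apply/funext.
  near=> z n => /=; exists i; first by near: n; exact: nbhs_infty_gt.
  have -> // : z i = y i by near: z; exact: nbhs_coord.
exists (mkseq x n); first exact: cylinder_mkseq.
move=> y yn; apply: VU; apply: contrapT => nVy.
have [i ilt] := nP n (leqnn n) y nVy.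
by rewrite (yn i) ?size_mkseq// nth_mkseq.
Unshelve. all: by end_near. Qed.

Lemma clopen_nbhs (x : cantor_space) (U : set cantor_space) :
  nbhs x U -> exists A, [/\ clopen A, A x & A `<=` U].
Proof.
by move=> /cylinder_basis[s sx sU]; exists (cylinder s); split=> //; exact: clopen_cylinder.
Qed.

(** If [U] were contained in [F], removing from [U] the finite closed set [F] minus [x] would leave
    the open singleton of [x], an isolated point. *)
Lemma open_setD_finite (T : topologicalType) (U F : set T) :
  accessible_space T -> perfect_set [set: T] ->
  open U -> U !=set0 -> finite_set F -> open (U `\` F) /\ U `\` F !=set0.
Proof.
move=> /accessible_finite_set_closed finC /perfectTP noiso oU [x Ux] finF; split.
  by rewrite setDE; apply: openI => //; apply: closed_openC; exact: finC.
apply: contrapT => UF0; apply: (noiso x).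
have UF : U `<=` F by move=> y Uy; apply: contrapT => nFy; apply: UF0; exists y.
have -> : [set x] = U `\` (F `\ x).
  apply/seteqP; split=> [y ->|y [Uy nFy]]; first by split=> // -[_]; exact.
  by apply: contrapT => yx; apply: nFy; split; [exact: UF|exact: yx].
have finFx : finite_set (F `\ x) by exact: finite_setD.
exact: (openI oU (closed_openC (finC _ finFx))).
Qed.

Lemma continuous_iter (T : topologicalType) (f : T -> T) (n : nat) :
  continuous f -> continuous (iter n f).
Proof.
move=> cf; elim: n => [|n IH] x; first exact: cvg_id.
by apply: (@continuous_comp _ _ _ (iter n f) f); [exact: IH|exact: cf].
Qed.

Lemma iter_can (T : Type) (f g : T -> T) (n : nat) :
  cancel f g -> cancel (iter n f) (iter n g).
Proof. by move=> fK; elim: n => [|n IH] x //; rewrite (iterSr n g) iterS fK IH. Qed.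

(** * Slowly varying bumps *)

Definition spread (T : Type) (h g : T -> T) (j : nat) (A : set T) : set T :=
  [set x | exists2 i, (i <= j)%N & A (iter i h x) \/ A (iter i g x)].

Lemma spread_sub (T : Type) (h g : T -> T) (j : nat) (A : set T) (x : T) :
  A x -> spread h g j A x.
Proof. by move=> Ax; exists 0%N => //; left. Qed.

Lemma spread_mono (T : Type) (h g : T -> T) (i j : nat) (A : set T) :
  (i <= j)%N -> spread h g i A `<=` spread h g j A.
Proof. by move=> ij x [k ki Ak]; exists k => //; exact: leq_trans ij. Qed.

Lemma spread_image (T : Type) (h g : T -> T) (j : nat) (A : set T) (x : T) :
  cancel h g -> spread h g j A x -> spread h g j.+1 A (h x).
Proof.
move=> hK [[|i] ij [Ax|Ax]].
- by exists 1%N => //; right; rewrite /= hK.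
- by exists 1%N => //; right; rewrite /= hK.
- by exists i; [exact: leqW (ltnW ij)|left; rewrite -iterSr].
- by exists i.+2 => //; right; rewrite iterSr hK.
Qed.

Lemma spread_preimage (T : Type) (h g : T -> T) (j : nat) (A : set T) (x : T) :
  cancel h g -> spread h g j A (h x) -> spread h g j.+1 A x.
Proof.
move=> hK [[|i] ij [Ax|Ax]].
- by exists 1%N => //; left.
- by exists 1%N => //; left.
- by exists i.+2 => //; left; rewrite iterSr.
- by exists i; [exact: leqW (ltnW ij)|right; move: Ax; rewrite iterSr hK].
Qed.

(** A passage from [B] to [A] in [i] iterates of [h] or [g], run backwards, is one from [A] to
    [B]. *)
Lemma spread_disjoint (T : Type) (h g : T -> T) (j : nat) (A B : set T) :
  cancel h g -> cancel g h ->
  (forall x, A x -> ~ spread h g j B x) -> forall x, B x -> ~ spread h g j A x.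
Proof.
move=> hK gK AB x Bx [i ij [|] Ai]; apply: AB Ai _; exists i => //.
  by right; rewrite iter_can.
by left; rewrite iter_can.
Qed.

(** Orbits starting in [P] stay in [P] in both time directions. This makes the bumps vanish on the
    periodic orbits used earlier. *)
Lemma spread_invariant (T : Type) (h g : T -> T) (j : nat) (A P : set T) :
  cancel g h -> (forall x, P (h x) <-> P x) -> (forall x, P x -> ~ A x) ->
  forall x, P x -> ~ spread h g j A x.
Proof.
move=> gK hP PA x Px [i _ [|]]; apply: PA.
  by elim: i => //= i IH; apply/hP.
by elim: i => //= i IH; apply/hP; rewrite gK.
Qed.

Lemma clopen_spread (T : topologicalType) (h g : T -> T) (j : nat) (A : set T) :
  continuous h -> continuous g -> clopen A -> clopen (spread h g j A).
Proof.
move=> ch cg cA.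
have -> : spread h g j A =
    \big[setU/set0]_(i < j.+1) (iter i h @^-1` A `|` iter i g @^-1` A).
  rewrite -(bigcup_mkord j.+1 (fun i => iter i h @^-1` A `|` iter i g @^-1` A)).
  by apply/seteqP; split=> [x [i ij Ai]|x [i /= ij Ai]]; exists i.
elim/big_ind : _ => [|B C [oB cB] [oC cC]|i _].
- by split; [exact: open0|exact: closed0].
- by split; [exact: openU|exact: closedU].
- have [oA clA] := cA; split.
    by apply: openU; apply: open_comp => // x _; exact: continuous_iter.
  by apply: closedU; apply: closed_comp => // x _; exact: continuous_iter.
Qed.

Lemma continuous_indic_clopen (R : realType) (T : topologicalType) (A : set T) :
  clopen A -> continuous (\1_A : T -> R).
Proof.
move=> [oA cA] x; apply: cvg_near_cst; have [Ax|nAx] := pselect (A x).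
  have : nbhs x A by exact: open_nbhs_nbhs.
  by apply: filterS => y Ay; rewrite !indicE !mem_set.
have : nbhs x (~` A) by apply: open_nbhs_nbhs; split=> //; exact: closed_openC.
by apply: filterS => y nAy; rewrite !indicE !memNset.
Qed.

(** For [N > 0], if [m] is the least number of iterates of [h] or [g] leading from [x] into [A], the
    value is [c * max (0, 1 - m / N)]. *)
Definition tent (R : realType) (T : Type) (h g : T -> T) (N : nat) (c : R)
  (A : set T) (x : T) : R :=
  c / N%:R * \sum_(j < N) \1_(spread h g j A) x.

Lemma tent_ge0 (R : realType) (T : Type) (h g : T -> T) (N : nat) (c : R)
  (A : set T) (x : T) : 0 <= c -> 0 <= tent h g N c A x.
Proof.
by move=> c0; rewrite mulr_ge0 ?divr_ge0 ?ler0n// sumr_ge0.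
Qed.

Lemma tent_on (R : realType) (T : Type) (h g : T -> T) (N : nat) (c : R)
  (A : set T) (x : T) : (0 < N)%N -> A x -> tent h g N c A x = c.
Proof.
move=> N0 Ax; rewrite /tent (eq_bigr (fun=> 1)) => [|j _].
  by rewrite sumr_const card_ord divfK// pnatr_eq0 -lt0n.
by rewrite indicE mem_set//; exact: spread_sub.
Qed.

Lemma tent_off (R : realType) (T : Type) (h g : T -> T) (N : nat) (c : R)
  (A : set T) (x : T) : ~ spread h g N A x -> tent h g N c A x = 0.
Proof.
move=> nAx; rewrite /tent big1 ?mulr0// => j _.
rewrite indicE memNset// => jx; apply: nAx.
exact: spread_mono (ltnW (ltn_ord j)) _ jx.
Qed.

Lemma continuous_tent (R : realType) (T : topologicalType) (h g : T -> T)
  (N : nat) (c : R) (A : set T) :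
  continuous h -> continuous g -> clopen A -> continuous (tent h g N c A).
Proof.
move=> ch cg cA x; apply: cvgM; first exact: cvg_cst.
apply: (@continuous_big R _ _ 0 xpredT) => [|j _]; first exact: add_continuous.
exact/continuous_indic_clopen/clopen_spread.
Qed.

(** Both sides are compared with the sum of [b] over [j < N + 1]: without its first term it
    dominates the sum of [a], and its last term is at most 1. *)
Lemma sum_shift_le (R : realType) (a b : nat -> R) (N : nat) :
  (forall j, a j <= b j.+1) -> 0 <= b 0%N -> b N <= 1 ->
  \sum_(j < N) a j <= \sum_(j < N) b j + 1.
Proof.
move=> ab b0 bN; apply: (@le_trans _ _ (\sum_(j < N.+1) b j)).
  by rewrite big_ord_recl ler_wpDl// ler_sum.
by rewrite big_ord_recr lerD2l.
Qed.

(* The sets [spread j A] form a chain whose consecutive members contain each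
   other's image and preimage, so applying [h] shifts the sum by one term. *)
Lemma tent_slow (R : realType) (T : Type) (h g : T -> T) (N : nat) (c : R)
  (A : set T) (x : T) : cancel h g -> 0 <= c ->
  `|tent h g N c A (h x) - tent h g N c A x| <= c / N%:R.
Proof.
move=> hK c0; rewrite /tent -mulrBr normrM ger0_norm ?divr_ge0 ?ler0n//.
rewrite ler_piMr ?divr_ge0 ?ler0n//.
have le_indic (B C : set T) y z : (B y -> C z) -> \1_B y <= \1_C z :> R.
  move=> BC; rewrite !indicE; case: (boolP (y \in B)) => [/set_mem/BC Cz|_].
    by rewrite mem_set.
  exact: ler0n.
have ind1 (B : set T) y : 0 <= (\1_B y : R) <= 1.
  by rewrite indicE ler0n lern1 leq_b1.
rewrite ler_distl lerBlDr; apply/andP; split.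
  apply: (sum_shift_le (a := fun j => \1_(spread h g j A) x)
    (b := fun j => \1_(spread h g j A) (h x))) => [j||].
  - by apply: le_indic; exact: spread_image.
  - by case/andP: (ind1 (spread h g 0 A) (h x)).
  - by case/andP: (ind1 (spread h g N A) (h x)).
apply: (sum_shift_le (a := fun j => \1_(spread h g j A) (h x))
  (b := fun j => \1_(spread h g j A) x)) => [j||].
- by apply: le_indic; exact: spread_preimage.
- by case/andP: (ind1 (spread h g 0 A) x).
- by case/andP: (ind1 (spread h g N A) x).
Qed.

(** * One step of the construction *)

Definition chaotic_homeo (h g : cantor_space -> cantor_space) :=
  [/\ cancel h g, cancel g h, continuous h, continuous g
    & chaotic_on [set: cantor_space] h].

(** Heights can only be lowered. Nothing is done if the height is already below [b]; otherwise it is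
    lowered to a point [t] between [a] and [b]. *)
Lemma exists_damping (R : realType) (w a b : R) :
  a < expR (- w) -> 0 < b -> a < b ->
  exists2 c, 0 <= c & a < expR (- (w + c)) < b.
Proof.
move=> aw b0 ab; have [wb|bw] := ltP (expR (- w)) b.
  by exists 0 => //; rewrite addr0 aw wb.
(* The maximum with 0 keeps [t] positive even for negative [a], so that [ln t] makes sense. *)
pose t : R := (Num.max a 0 + b) / 2.
have m0 : 0 <= Num.max a 0 by rewrite le_max lexx orbT.
have am : a <= Num.max a 0 by rewrite le_max lexx.
have mb : Num.max a 0 < b by rewrite gt_max ab b0.
have t0 : 0 < t by rewrite /t; lra.
exists (- ln t - w).
  suff : ln t <= - w by lra.
  by rewrite -ler_expR lnK ?posrE//; apply: le_trans bw; rewrite /t; lra.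
rewrite [w + _]addrC subrK opprK lnK ?posrE//; apply/andP; split; rewrite /t; lra.
Qed.

(** Transitivity makes the open set of points of [A] sent into [B] by some [iter k h] nonempty;
    density then puts a periodic point in it. *)
Lemma chaotic_periodic_visit (T : topologicalType) (h : T -> T) (A B : set T) :
  continuous h -> chaotic_on [set: T] h -> open A -> open B ->
  A !=set0 -> B !=set0 ->
  exists p k n, [/\ (0 < k)%N, (0 < n)%N, iter n h p = p, A p & B (iter k h p)].
Proof.
move=> ch [tr [_ dense_per]] oA oB A0 B0.
have [k [k0 [x [[Ax _] Bx]]]] : exists k, (0 < k)%N /\
    exists x, (A `&` [set: T]) x /\ B (iter k h x).
  by apply: tr; rewrite ?setIT.
have oAB : open (A `&` iter k h @^-1` B).
  by apply: openI => //; apply: open_comp => // y _; exact: continuous_iter.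
have [p [[Ap Bp] [_ [n [n0 np]]]]] := dense_per _ oAB (ex_intro _ x (conj (conj Ax Bx) I)).
by exists p, k, n.
Qed.

Lemma periodic_orbit (T : Type) (h g : T -> T) (n : nat) (p : T) :
  cancel h g -> cancel g h -> (0 < n)%N -> iter n h p = p ->
  exists O : set T,
    [/\ finite_set O, forall x, O (h x) <-> O x & O p].
Proof.
move=> hK gK n0 np; exists ((fun i => iter i h p) @` `I_n); split.
- exact/finite_image/finite_II.
- move=> x; split=> [[i ilt] ix|[i ilt <-]].
    have {ix} -> : x = g (iter i h p) by rewrite ix hK.
    case: i ilt => [_|i ilt]; last by exists i; [exact: ltnW|rewrite /= hK].
    exists n.-1; first by rewrite /= prednK.
    by rewrite /= -[in RHS]np -(prednK n0) /= hK.
  have [ni|ni] := eqVneq n i.+1.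
    by exists 0%N => //=; rewrite -iterS -ni np.
  by exists i.+1 => //=; rewrite ltn_neqAle eq_sym ni.
- by exists 0%N.
Qed.

(** [Q p] places the orbit among those on which later stages are frozen, so the height conditions
    survive in the limit. *)
Definition visits (R : realType) (h : cantor_space -> cantor_space)
    (w : cantor_space -> R) (Q U V : set cantor_space) (a b a' b' : R) :=
  exists p k n, [/\ (0 < k)%N, (0 < n)%N & iter n h p = p] /\
    [/\ Q p, U p, V (iter k h p), a < expR (- w p) < b
      & a' < expR (- w (iter k h p)) < b'].

Lemma open_expN_itv (R : realType) (T : topologicalType) (w : T -> R) (c a b : R) :
  continuous w -> open [set x | a < expR (- (w x + c)) < b].
Proof.
move=> cw; have -> : [set x | a < expR (- (w x + c)) < b] =
    (fun x => expR (- (w x + c))) @^-1` [set` `]a, b[].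
  by apply/seteqP; split=> x /=; rewrite in_itv.
apply: open_comp => [x _|]; last exact: itv_open.
apply: continuous_comp; last exact: continuous_expR.
by apply: cvgN; apply: cvgD; [exact: cw|exact: cvg_cst].
Qed.

Lemma open_expN_gt (R : realType) (T : topologicalType) (w : T -> R) (a : R) :
  continuous w -> open [set x | a < expR (- w x)].
Proof.
move=> cw; have -> : [set x | a < expR (- w x)] =
    (fun x => expR (- w x)) @^-1` [set` `]a, +oo[].
  by apply/seteqP; split=> x /=; rewrite in_itv/= andbT.
apply: open_comp => [x _|]; last exact: rray_open.
apply: continuous_comp; last exact: continuous_expR.
by apply: cvgN; exact: cw.
Qed.

Lemma perturbation (R : realType) (h g : cantor_space -> cantor_space)
    (w : cantor_space -> R) (P U V : set cantor_space) (d a b a' b' : R) :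
  chaotic_homeo h g -> continuous w -> finite_set P ->
  (forall x, P (h x) <-> P x) -> 0 < d -> open U -> open V ->
  0 < b -> a < b -> 0 < b' -> a' < b' ->
  (exists2 x, U x & a < expR (- w x)) ->
  (exists2 y, V y & a' < expR (- w y)) ->
  exists (v : cantor_space -> R) (Q : set cantor_space), [/\ continuous v, forall x, 0 <= v x,
      forall x, `|v (h x) - v x| <= d & forall x, P x -> v x = 0] /\
    [/\ finite_set Q, forall x, Q (h x) <-> Q x, P `<=` Q
      & visits h (fun x => w x + v x) Q U V a b a' b'].
Proof.
move=> [hK gK ch cg chh] cw finP invP d0 oU oV b0 ab b'0 ab' [x0 Ux0 ax0] [y0 Vy0 ay0].
have accC : accessible_space cantor_space.
  exact/hausdorff_accessible/cantor_space_hausdorff.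
have perfC := cantor_perfect.
have oU1 := openI oU (open_expN_gt a cw).
have oV1 := openI oV (open_expN_gt a' cw).
have [oU2 [x [[Ux ax] nPx]]] :=
  open_setD_finite accC perfC oU1 (ex_intro _ x0 (conj Ux0 ax0)) finP.
have [oV2 [y1 [[Vy1 ay1] nPy1]]] :=
  open_setD_finite accC perfC oV1 (ex_intro _ y0 (conj Vy0 ay0)) finP.
have [c c0 cx] := exists_damping ax b0 ab.
have [c' c'0 cy1] := exists_damping ay1 b'0 ab'.
(* Each of the two bumps may use half of the allowed variation [d]. *)
have [N N0 [cN c'N]] : exists2 N, (0 < N)%N & c / N%:R <= d / 2 /\ c' / N%:R <= d / 2.
  exists (Num.truncn ((c + c') / (d / 2))).+1 => //.
  have := truncnS_gt ((c + c') / (d / 2)).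
  rewrite ltr_pdivrMr ?divr_gt0// => lt.
  by split; rewrite ler_pdivrMr ?ltr0n//; lra.
(* The height [c'] chosen at [y1] remains suitable on an open set, so [y1] can still be moved to a
   point [y] inside it. *)
have oV3 := openI oV2 (open_expN_itv c' a' b' cw).
(* The points within [N] iterates of [x]. Once [B] avoids them, [x] lies outside [spread h g N B],
   and [A] can be shrunk around [x] to avoid that closed set. *)
pose O := [set iter i h x | i in `I_N.+1] `|` [set iter i g x | i in `I_N.+1].
have finO : finite_set O.
  by rewrite finite_setU; split; exact/finite_image/finite_II.
have [oV4 [y [[[[Vy ay] nPy] cy] nOy]]] := open_setD_finite accC perfC oV3
  (ex_intro _ y1 (conj (conj (conj Vy1 ay1) nPy1) cy1)) finO.
have [B [clB By BV]] := clopen_nbhs (open_nbhs_nbhs (conj oV4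
  (conj (conj (conj (conj Vy ay) nPy) cy) nOy))).
have nBx : ~ spread h g N B x.
  move=> [i iN [|] /BV[_]]; apply; [left|right]; by exists i.
have oU3 := openI oU2 (open_expN_itv c a b cw).
have clBN : clopen (spread h g N B) by exact: clopen_spread.
have oU4 := openI oU3 (closed_openC clBN.2).
have [A [clA Ax AU]] := clopen_nbhs (open_nbhs_nbhs (conj oU4
  (conj (conj (conj (conj Ux ax) nPx) cx) nBx))).
have AB z : A z -> ~ spread h g N B z by case/AU.
have BA : forall z, B z -> ~ spread h g N A z by exact: spread_disjoint.
have [p [k [n [k0 n0 np Ap Bp]]]] := chaotic_periodic_visit ch chh clA.1 clB.1
  (ex_intro _ x Ax) (ex_intro _ y By).
have [Op [finOp invOp Opp]] := periodic_orbit hK gK n0 np.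
pose v z := tent h g N c A z + tent h g N c' B z.
have vA z : A z -> v z = c.
  by move=> Az; rewrite /v tent_on// tent_off ?addr0//; exact: AB.
have vB z : B z -> v z = c'.
  by move=> Bz; rewrite /v [tent _ _ _ c' _ _]tent_on// tent_off ?add0r//; exact: BA.
exists v, (P `|` Op); split; split.
- by move=> z; apply: cvgD; exact: continuous_tent.
- by move=> z; rewrite addr_ge0// tent_ge0.
- move=> z; rewrite /v opprD addrACA (le_trans (ler_normD _ _))//.
  rewrite [leRHS]splitr lerD//; [exact: le_trans (tent_slow _ _ _ hK c0) cN|
    exact: le_trans (tent_slow _ _ _ hK c'0) c'N].
- move=> z Pz; rewrite /v !tent_off ?addr0//;
    apply: (spread_invariant gK invP _ Pz) => t Pt.
    by case/BV => -[[_ +] _] _; exact.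
  by case/AU => -[[_ +] _] _; exact.
- by rewrite finite_setU.
- move=> z; split=> -[?|?];
    by [left; exact/invP|right; exact/invOp].
- by move=> z Pz; left.
- have [[[[Up _] _] cp] _] := AU _ Ap; have [[[[Vp _] _] cq] _] := BV _ Bp.
  exists p, k, n; split=> //; split=> //; first by right.
    by rewrite vA.
  by rewrite vB.
Qed.

(** * The sequence of steps *)

(* The second component of a stage is a finite invariant set of points at which
   all later functions keep their current value. *)
Definition stage_ok (R : realType) (h : cantor_space -> cantor_space)
    (st : (cantor_space -> R) * set cantor_space) :=
  [/\ continuous st.1, finite_set st.2 & forall x, st.2 (h x) <-> st.2 x].

(** Since later stages only lower [expR (- w x)], the present height has to exceed [a] but may lie
    above [b]. *)
Definition reachable (R : realType) (w : cantor_space -> R)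
    (U : set cantor_space) (a b : R) :=
  [/\ 0 < b, a < b & exists2 x, U x & a < expR (- w x)].

(** The second clause bounds the change of the coboundary [w o h - w], not of [w] itself; these
    changes will be summable along the tower. *)
Definition stage_step (R : realType) (h : cantor_space -> cantor_space)
    (d : R) (U V : set cantor_space) (a b a' b' : R)
    (st st' : (cantor_space -> R) * set cantor_space) :=
  [/\ forall x, st.1 x <= st'.1 x,
      forall x, `|(st'.1 (h x) - st'.1 x) - (st.1 (h x) - st.1 x)| <= d,
      forall x, st.2 x -> st'.1 x = st.1 x,
      st.2 `<=` st'.2 &
      reachable st.1 U a b -> reachable st.1 V a' b' ->
      visits h st'.1 st'.2 U V a b a' b'].

Lemma stage_step_exists (R : realType) (h g : cantor_space -> cantor_space)
    (d : R) (U V : set cantor_space) (a b a' b' : R)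
    (st : (cantor_space -> R) * set cantor_space) :
  chaotic_homeo h g -> 0 < d -> open U -> open V -> stage_ok h st ->
  exists st', stage_ok h st' /\ stage_step h d U V a b a' b' st st'.
Proof.
move=> hC d0 oU oV; case: st => w P [/= cw finP invP].
have [[[b0 ab Ux] [b'0 ab' Vx]]|nr] :=
    pselect (reachable w U a b /\ reachable w V a' b'); last first.
  (* An unreachable target imposes nothing, so the stage is repeated unchanged. *)
  exists (w, P); split; split=> //= => [x|rU rV]; last by case: nr.
  by rewrite subrr normr0 ltW.
have [v [Q [[cv v0 vd vP] [finQ invQ PQ vis]]]] :=
  perturbation hC cw finP invP d0 oU oV b0 ab b'0 ab' Ux Vx.
exists ((fun x => w x + v x), Q); split; split=> //=.
- by move=> x; apply: cvgD; [exact: cw|exact: cv].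
- by move=> x; rewrite lerDl.
- by move=> x; rewrite (_ : _ - _ = v (h x) - v x)//; ring.
- by move=> x /vP ->; rewrite addr0.
Qed.

(** Two boxes, each a cylinder times a rational interval. The type is countable, so stage [n] can
    treat the task coded by [n]. *)
Definition task : Type := (seq bool * seq bool * (rat * rat) * (rat * rat))%type.

(* At indices coding no task the default has [b = 0], hence is never [reachable]. *)
Definition task_of (n : nat) : task := odflt ([::], [::], (0, 0), (0, 0)) (unpickle n).

Definition tower_step (R : realType) (h : cantor_space -> cantor_space) (n : nat)
    (st st' : (cantor_space -> R) * set cantor_space) :=
  let: (s, s', (a, b), (a', b')) := task_of n in
  stage_step h (2 ^- n) (cylinder s) (cylinder s')
    (ratr a) (ratr b) (ratr a') (ratr b') st st'.

Lemma tower_exists (R : realType) (h g : cantor_space -> cantor_space) :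
  chaotic_homeo h g ->
  exists f : nat -> (cantor_space -> R) * set cantor_space,
    [/\ forall x, (f 0%N).1 x = 0, forall n, stage_ok h (f n)
      & forall n, tower_step h n (f n) (f n.+1)].
Proof.
move=> hC.
(* Stages carry their index, because the step to be chosen depends on [n]. *)
pose X := {nst : nat * ((cantor_space -> R) * set cantor_space) | stage_ok h nst.2}.
pose S (x y : X) := (sval y).1 = (sval x).1.+1 /\
  tower_step h (sval x).1 (sval x).2 (sval y).2.
have step (x : X) : {y : X | S x y}.
  apply: cid; case: x => -[n st] /= okst; rewrite /S /tower_step/=.
  case: (task_of n) => [[[s s'] [a b]] [a' b']].
  have d0 : 0 < 2 ^- n :> R by rewrite invr_gt0 exprn_gt0.
  have [st' [okst' stst']] := stage_step_exists (ratr a) (ratr b) (ratr a') (ratr b') hC d0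
    (clopen_cylinder s).1 (clopen_cylinder s').1 okst.
  by exists (exist _ (n.+1, st') okst').
have ok0 : stage_ok h ((fun=> 0) : cantor_space -> R, set0).
  by split=> //=; first exact: cst_continuous.
have [F [F0 FS]] := dependent_choice step (exist _ (0%N, _) ok0).
have Fn n : (sval (F n)).1 = n.
  by elim: n => [|n IH]; [rewrite F0|have [-> _] := FS n; rewrite IH].
exists (fun n => (sval (F n)).2); split=> [x|n|n]; first by rewrite F0.
  exact: svalP (F n).
by have [_] := FS n; rewrite Fn.
Qed.

(** * The height function and the skew product *)

Lemma cvg_double_expN (R : realType) : (2 * 2 ^- n : R) @[n --> \oo] --> (0 : R).
Proof.
rewrite -[X in _ --> X](mulr0 2); apply: cvgM; first exact: cvg_cst.
under eq_fun do rewrite -exprVn.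
by apply: cvg_expr; rewrite ger0_norm ?invr_ge0// invf_lt1// ltr1n.
Qed.

(* [u n + 2^(1-n)] decreases and [u n - 2^(1-n)] increases to the same limit. *)
Lemma geometric_increments (R : realType) (u : nat -> R) :
  (forall n, `|u n.+1 - u n| <= 2 ^- n) ->
  exists l, u n @[n --> \oo] --> l /\ forall n, `|l - u n| <= 2 * 2 ^- n.
Proof.
move=> du.
have cvg0 := @cvg_double_expN R.
have half n : 2 * 2 ^- n.+1 = 2 ^- n :> R.
  by rewrite exprS invfM mulrA divff ?mul1r ?pnatr_eq0.
pose dn n := u n + 2 * 2 ^- n; pose up n := u n - 2 * 2 ^- n.
have dn_dec : {homo dn : n m / (n <= m)%N >-> m <= n}.
  apply/nonincreasing_seqP => n; rewrite /dn half.
  by move: (du n); rewrite ler_distl => /andP[_]; lra.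
have up_inc : {homo up : n m / (n <= m)%N >-> n <= m}.
  apply/nondecreasing_seqP => n; rewrite /up half.
  by move: (du n); rewrite ler_distl => /andP[+ _]; lra.
have updn n : up n <= dn n.
  by rewrite /up /dn; have : 0 <= 2 ^- n :> R by []; lra.
have cdn : cvgn dn.
  apply: nonincreasing_is_cvgn => //; exists (up 0%N) => _ [n _ <-].
  by apply: (le_trans (up_inc _ _ (leq0n n))); exact: updn.
have cu : u n @[n --> \oo] --> limn dn.
  have -> : u = (fun n => dn n - 2 * 2 ^- n) by apply/funext => n; rewrite addrK.
  by rewrite -[X in _ --> X]subr0; apply: cvgB.
have cup : up n @[n --> \oo] --> limn dn.
  by rewrite -[X in _ --> X]subr0; apply: cvgB.
exists (limn dn); split=> // n; rewrite ler_distl; apply/andP; split; last first.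
  exact: nonincreasing_cvgn_ge.
rewrite -(cvg_lim (@Rhausdorff R) cup).
apply: nondecreasing_cvgn_le => //; by apply/cvg_ex; exists (limn dn).
Qed.

(** The tail bound [2 * 2 ^- n] does not depend on the point, so the limit is uniform and the usual
    [e / 3] argument applies. *)
Lemma geometric_increments_continuous (R : realType) (T : topologicalType)
    (u : nat -> T -> R) :
  (forall n, continuous (u n)) ->
  (forall n x, `|u n.+1 x - u n x| <= 2 ^- n) ->
  exists2 G : T -> R, continuous G & forall x, u n x @[n --> \oo] --> G x.
Proof.
move=> cu du.
have [G uG] := choice (fun x => geometric_increments (fun n => du n x)).
exists G => [x|x]; last by have [] := uG x.
apply/cvgrPdist_lt => e e0.
have cvg0 := @cvg_double_expN R.
have e3 : 0 < e / 3 by rewrite divr_gt0.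
have /cvgrPdist_lt/(_ _ e3)[n _ /(_ n (leqnn n))] := cvg0.
rewrite /= sub0r normrN ger0_norm// => ne.
have /cvgrPdist_lt/(_ _ e3) := cu n x.
apply: filterS => y xy.
have := (uG x).2 n; have := (uG y).2 n; move: xy.
rewrite !ler_distl !ltr_distl => /andP[? ?] /andP[? ?] /andP[? ?].
by apply/andP; split; lra.
Qed.

(** The hypotheses bound [phi] only from below: a box meeting the fence may meet it well under the
    top. *)
Definition tops_dense (R : realType) (h : cantor_space -> cantor_space)
    (phi : cantor_space -> R) :=
  forall (s s' : seq bool) (a b a' b' : rat),
  0 < b -> a < b -> 0 < b' -> a' < b' ->
  (exists2 x, cylinder s x & ratr a < phi x) ->
  (exists2 x, cylinder s' x & ratr a' < phi x) ->
  exists p k n, [/\ (0 < k)%N, (0 < n)%N & iter n h p = p] /\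
    [/\ cylinder s p, cylinder s' (iter k h p), 0 < phi p,
        ratr a < phi p < ratr b & ratr a' < phi (iter k h p) < ratr b'].

(** As a decreasing limit of continuous functions, [phi] is upper semicontinuous, and its functional
    equation is the limit of those of the stages. On the chosen orbits the limit is attained at a
    finite stage, so strict inequalities and positivity are not lost. *)
Lemma height_exists (R : realType) (h g : cantor_space -> cantor_space) :
  chaotic_homeo h g ->
  exists phi G : cantor_space -> R,
    [/\ forall x, 0 <= phi x <= 1, usc phi, continuous G,
        forall x, phi (h x) = phi x * expR (- G x) & tops_dense h phi].
Proof.
move=> hC; have [f [f0 okf stepf]] := tower_exists R hC.
pose w n := (f n).1.
have [w_le dw w_keep Q_le] : [/\ forall n x, w n x <= w n.+1 x,
    forall n x, `|(w n.+1 (h x) - w n.+1 x) - (w n (h x) - w n x)| <= 2 ^- n,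
    forall n x, (f n).2 x -> w n.+1 x = w n x &
    forall n, (f n).2 `<=` (f n.+1).2].
  split=> n; have := stepf n; rewrite /tower_step;
    by case: (task_of n) => [[[s s'] [a b]] [a' b']] [].
have w_mono x n m : (n <= m)%N -> w n x <= w m x.
  by move: n m; apply/nondecreasing_seqP => n; exact: w_le.
have w_ge0 n x : 0 <= w n x by rewrite -(f0 x); exact: w_mono.
have w_stable n x m : (f n).2 x -> (n <= m)%N -> (f m).2 x /\ w m x = w n x.
  move=> Qx; elim: m => [|m IH]; first by rewrite leqn0 => /eqP <-.
  rewrite leq_eqVlt => /predU1P[<- //|/IH[Qm wm]].
  by split; [exact: Q_le|rewrite w_keep].
have e_dec x : {homo (fun n => expR (- w n x)) : n m / (n <= m)%N >-> m <= n}.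
  by move=> n m nm; rewrite ler_expR lerN2 w_mono.
(* The limit is taken after exponentiating, as [w n x] may tend to infinity; [phi x] is then 0. *)
pose phi x := limn (fun n => expR (- w n x)).
have cphi x : expR (- w n x) @[n --> \oo] --> phi x.
  apply: nonincreasing_is_cvgn => //; exists 0 => _ [n _ <-]; exact: expR_ge0.
have phi_le n x : phi x <= expR (- w n x).
  by apply: (nonincreasing_cvgn_ge (@e_dec x)); exact: cphi.
have phi_stable n x : (f n).2 x -> phi x = expR (- w n x).
  move=> Qx; apply: cvg_lim; first exact: Rhausdorff.
  apply: cvg_near_cst; exists n => // m /= nm.
  by have [_ ->] := w_stable _ _ _ Qx nm.
have [G cG wG] : exists2 G : cantor_space -> R, continuous G &
    forall x, w n (h x) - w n x @[n --> \oo] --> G x.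
  apply: (geometric_increments_continuous (u := fun n x => w n (h x) - w n x)) => // n x.
  have [cw _ _] := okf n; have [_ _ ch _ _] := hC.
  apply: cvgB; last exact: cw.
  by apply: continuous_comp; [exact: ch|exact: cw].
exists phi, G; split=> //.
- move=> x; apply/andP; split.
    by apply: limr_ge; [exact: cphi|apply: nearW => n; exact: expR_ge0].
  by rewrite (le_trans (phi_le 0%N x))// -[leRHS]expR0 ler_expR oppr_le0.
- move=> x a xa; have [n na] : exists n, expR (- w n x) < a.
    apply: contrapT => nE; move: xa; apply/negP; rewrite -leNgt.
    apply: limr_ge; first exact: cphi.
    by apply: nearW => n; rewrite leNgt; apply/negP => na; apply: nE; exists n.
  have [cw _ _] := okf n.
  have ce : expR (- w n y) @[y --> x] --> expR (- w n x).
    have cN : - w n y @[y --> x] --> - w n x by apply: cvgN; exact: cw.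
    exact: (cvg_comp _ _ cN (@continuous_expR R _)).
  by apply: filterS (cvgr_lt _ ce _ na) => y; exact: le_lt_trans.
- move=> x; apply: cvg_lim; first exact: Rhausdorff.
  have -> : (fun n => expR (- w n (h x))) =
      (fun n => expR (- w n x) * expR (- (w n (h x) - w n x))).
    by apply/funext => n; rewrite -expRD; congr expR; ring.
  apply: cvgM; first exact: cphi.
  have cN : - (w n (h x) - w n x) @[n --> \oo] --> - G x by apply: cvgN; exact: wG.
  exact: (cvg_comp _ _ cN (@continuous_expR R _)).
- move=> s s' a b a' b' b0 ab b'0 ab' [x sx ax] [y sy ay].
  pose n := pickle ((s, s', (a, b), (a', b')) : task).
  have tn : task_of n = (s, s', (a, b), (a', b')) by rewrite /task_of pickleK.
  have := stepf n; rewrite /tower_step tn => -[_ _ _ _].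
  (* A lower bound for [phi] holds at every stage, since [phi] lies below each [expR (- w n x)]. *)
  have reach c d t z : 0 < d -> c < d -> cylinder t z -> ratr c < phi z ->
      reachable (f n).1 (cylinder t) (ratr c) (ratr d).
    move=> d0 cd tz cz; split; [by rewrite ltr0q|by rewrite ltr_rat|].
    by exists z => //; exact: lt_le_trans cz (phi_le _ _).
  move=> /(_ (reach _ _ _ _ b0 ab sx ax) (reach _ _ _ _ b'0 ab' sy ay)).
  case=> p [k [l [kln [Qp sp s'p ap a'p]]]]; exists p, k, l; split=> //.
  have [_ _ invQ] := okf n.+1.
  have Qkp : (f n.+1).2 (iter k h p) by elim: (k) => //= i IH; apply/invQ.
  by rewrite !(phi_stable n.+1)//; split=> //; exact: expR_gt0.
Qed.

Lemma rational_box (R : realType) (U : set (cantor_space * R)) (x : cantor_space) (t : R) :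
  open U -> U (x, t) ->
  exists (s : seq bool) (a b : rat), [/\ cylinder s x, ratr a < t, t < ratr b &
    forall y u, cylinder s y -> ratr a < u < ratr b -> U (y, u)].
Proof.
move=> oU Uxt.
have [[A B] /= [nA nB] ABU] : nbhs (x, t) U by exact: open_nbhs_nbhs.
have [s sx sA] := cylinder_basis nA.
have /nbhs_ballP[e /= e0 eB] := nB.
have [a] : exists a, ratr a \in `]t - e, t[ by apply: rat_in_itvoo; rewrite ltrBlDr ltrDl.
rewrite in_itv/= => /andP[ea at_].
have [b] : exists b, ratr b \in `]t, t + e[ by apply: rat_in_itvoo; rewrite ltrDl.
rewrite in_itv/= => /andP[tb be].
exists s, a, b; split=> // y u sy /andP[au ub]; apply: (ABU (y, u)); split.
  exact: sA.
by apply: eB; rewrite /ball/= ltr_distlC; apply/andP; split; lra.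
Qed.

(** A fence point [(x, t)] in a rational box satisfies [0 <= t < ratr b] and [ratr a < t <= phi x],
    which are the hypotheses of [tops_dense]. *)
Lemma tops_visit (R : realType) (h : cantor_space -> cantor_space)
    (phi : cantor_space -> R) (U V : set (cantor_space * R)) :
  tops_dense h phi -> open U -> open V ->
  U `&` fence (fun=> 0) phi !=set0 -> V `&` fence (fun=> 0) phi !=set0 ->
  exists p k n, [/\ (0 < k)%N, (0 < n)%N & iter n h p = p] /\
    [/\ 0 < phi p, U (p, phi p) & V (iter k h p, phi (iter k h p))].
Proof.
move=> td oU oV [[x t] [Uxt /andP[/= t0 tx]]] [[y u] [Vyu /andP[/= u0 uy]]].
have [s [a [b [sx at_ tb UP]]]] := rational_box oU Uxt.
have [s' [a' [b' [sy au ub VP]]]] := rational_box oV Vyu.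
have [||||||p [k [n [kn [sp s'p p0 ap a'p]]]]] := td s s' a b a' b'.
- by rewrite -(@ltr0q R); exact: le_lt_trans tb.
- by rewrite -(@ltr_rat R); exact: lt_trans tb.
- by rewrite -(@ltr0q R); exact: le_lt_trans ub.
- by rewrite -(@ltr_rat R); exact: lt_trans ub.
- by exists x => //; exact: lt_le_trans tx.
- by exists y => //; exact: lt_le_trans uy.
by exists p, k, n; split=> //; split=> //; [exact: UP|exact: VP].
Qed.

Definition skew (R : realType) (h : cantor_space -> cantor_space)
    (G : cantor_space -> R) (z : cantor_space * R) : cantor_space * R :=
  (h z.1, z.2 * expR (- G z.1)).

Lemma continuous_skew (R : realType) (h : cantor_space -> cantor_space)
    (G : cantor_space -> R) : continuous h -> continuous G -> continuous (skew h G).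
Proof.
move=> ch cG z.
have c1 : y.1 @[y --> z] --> z.1 by exact: cvg_fst.
have cGz : - G y.1 @[y --> z] --> - G z.1.
  by apply: cvgN; exact: (cvg_comp _ _ c1 (cG _)).
have c2 : y.2 * expR (- G y.1) @[y --> z] --> z.2 * expR (- G z.1).
  by apply: cvgM; [exact: cvg_snd|exact: (cvg_comp _ _ cGz (@continuous_expR R _))].
exact: (cvg_pair (cvg_comp _ _ c1 (ch _)) c2).
Qed.

(** The inverse is again a skew product, over [g]: the factor picked up at [y] is undone at
    [h y]. *)
Lemma skewK (R : realType) (h g : cantor_space -> cantor_space) (G : cantor_space -> R) :
  cancel h g -> cancel (skew h G) (skew g (fun y => - G (g y))).
Proof.
by move=> hK [y t]; rewrite /skew/= hK opprK -mulrA -expRD addNr expR0 mulr1.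
Qed.

Lemma iter_skew_top (R : realType) (h : cantor_space -> cantor_space)
    (phi G : cantor_space -> R) (n : nat) (p : cantor_space) :
  (forall x, phi (h x) = phi x * expR (- G x)) ->
  iter n (skew h G) (p, phi p) = (iter n h p, phi (iter n h p)).
Proof. by move=> phih; elim: n => //= n ->; rewrite /skew/= phih. Qed.

Theorem theorem7p2 (R : realType) (h : cantor_space -> cantor_space) :
  homeo_on [set: cantor_space] h -> chaotic_on [set: cantor_space] h ->
  exists (phiL phiU : cantor_space -> R),
    admissible phiL phiU /\ lelek_fence phiL phiU /\
    exists hh : cantor_space * R -> cantor_space * R,
      homeo_on (fence phiL phiU) hh /\ chaotic_on (fence phiL phiU) hh /\
      (forall y t, fence phiL phiU (y, t) -> (hh (y, t)).1 = h y).
Proof.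
move=> [_ [ch [g [_ [cg [hK gK]]]]]] chaos.
have {ch cg hK gK} hC : chaotic_homeo h g.
  by split=> //; [move=> x; exact: hK|move=> x; exact: gK|
    exact/continuous_subspace_setT|exact/continuous_subspace_setT].
have [phi [G [phi01 usc_phi cG phih td]]] := height_exists R hC.
have [hK gK ch cg _] := hC.
have topF p : fence (fun=> 0) phi (p, phi p).
  by rewrite /fence/= lexx andbT; case/andP: (phi01 p).
exists (fun=> 0), phi; split; [|split].
- split; [|split=> //; split; [|split=> //]].
  + by move=> x; rewrite lexx ler01.
  + by move=> x a a0; exact: (nearW (nbhs_filter x) (fun=> a0)).
  + by move=> x; case/andP: (phi01 x).
- split=> //; split.
    move=> O [x Ox] oO.
    (* The tube over [O] contains the top over [x], so a visit to it yields a point of [O] with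
       positive height. *)
    have oU : open (fst @^-1` O : set (cantor_space * R)).
      by apply: open_comp => // z _; exact: cvg_fst.
    have U0 : (fst @^-1` O : set (cantor_space * R)) `&` fence (fun=> 0) phi !=set0.
      by exists (x, phi x); split=> //; exact: topF.
    by have [p [k [n [_ [p0 Op _]]]]] := tops_visit td oU oU U0 U0; exists p.
  split=> [[x t] tx|U oU U0]; first by have -> : t = phi x := tx; exact: topF.
  have [p [k [n [_ [_ Up _]]]]] := tops_visit td oU oU U0 U0.
  by exists (p, phi p).
- exists (skew h G); split; [|split=> //; split; [|split]].
  + split; [|split].
    * move=> [x t]; rewrite /fence/= => /andP[t0 tx].
      by rewrite phih mulr_ge0 ?expR_ge0// ler_pM2r ?expR_gt0.
    * exact/continuous_subspaceT/continuous_skew.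
    exists (skew g (fun y => - G (g y))); split; [|split; [|split]].
    * move=> [x t]; rewrite /fence/= => /andP[t0 tx].
      rewrite opprK mulr_ge0 ?expR_ge0//=; move: tx.
      (* Writing [x] as [h (g x)] turns [phi x] into [phi (g x) * expR (- G (g x))]. *)
      by rewrite -{1}[x]gK phih expRN -ler_pdivlMr ?invr_gt0 ?expR_gt0// invrK.
    * apply/continuous_subspaceT/continuous_skew => // x.
      by apply: cvgN; apply: (cvg_comp _ _ (cg x)); exact: cG.
    * by move=> z _; exact: skewK.
    (* With [h] and [g] exchanged, the cocycle of the inverse of the inverse is [- - G (g (h y))],
       that is [G]. *)
    * move=> z _; have := skewK (fun y => - G (g y)) gK z.
      by rewrite (_ : (fun y => - - G (g (h y))) = G)//; apply/funext => y; rewrite opprK hK.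
  + move=> U V oU oV U0 V0.
    have [p [k [n [[k0 _ _] [_ Up Vp]]]]] := tops_visit td oU oV U0 V0.
    exists k; split=> //; exists (p, phi p); split; first by split=> //; exact: topF.
    by rewrite iter_skew_top.
  + by move=> z [].
  + move=> U oU U0.
    have [p [k [n [[_ n0 np] [_ Up _]]]]] := tops_visit td oU oU U0 U0.
    exists (p, phi p); split=> //; split; first exact: topF.
    by exists n; split=> //; rewrite iter_skew_top// np.
Qed.
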